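(* Let $M^{2m}$ be an almost Hermitian manifold, $N^{2n}$ an oriented even-dimensional Riemannian manifold, and $\psi:M\to\Sigma^+N$ an $\mathcal{H}$-holomorphic map. Then the projected map $\varphi=\pi\circ\psi:M\to N$ is weakly pluriconformal.
   Context: Twistor space: $\pi:\Sigma^+N\to N$ is the bundle whose fibre at $x$ is the set of orthogonal $J:T_xN\to T_xN$ with $J^2=-\mathrm{Id}$ that are positive (bases $\{e_1,Je_1,\dots,e_n,Je_n\}$ are positively oriented). The Levi-Civita connection on $\mathrm{End}(TN)\supseteq\Sigma^+N$ gives the splitting $T\Sigma^+N=\mathcal{H}\oplus\mathcal{V}$ into horizontal and vertical parts, $\mathcal{V}=\ker\mathrm{d}\pi$. On $\mathcal{H}_{(x,J)}$ there is the complex structure $\mathcal{J}^{\mathcal{H}}=(\mathrm{d}\pi|_{\mathcal{H}})^{-1}\circ J\circ\mathrm{d}\pi|_{\mathcal{H}}$. A smooth map $\psi:(M,J^M)\to\Sigma^+N$ is $\mathcal{H}$-holomorphic if $(\mathrm{d}\psi(J^MX))^{\mathcal{H}}=\mathcal{J}^{\mathcal{H}}(\mathrm{d}\psi X)^{\mathcal{H}}$ for all $X\in TM$. A smooth map $\varphi:M\to N$ is weakly pluriconformal if $\langle\mathrm{d}\varphi_xX^{10},\mathrm{d}\varphi_xY^{10}\rangle=0$ for all $x\in M$ and $X^{10},Y^{10}\in T^{10}_xM$, with $\langle\cdot,\cdot\rangle$ the complex-bilinear extension of the metric of $N$. *)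

(* Defs.v *)
From HB Require Import structures.
From mathcomp Require Import all_boot all_order all_algebra.
From mathcomp Require Import complex.
From mathcomp Require Import all_classical all_reals all_analysis.

Set Implicit Arguments.
Unset Strict Implicit.
Unset Printing Implicit Defensive.

Import Order.TTheory GRing.Theory Num.Theory.
Import numFieldNormedType.Exports.

Local Open Scope classical_set_scope.
Local Open Scope ring_scope.

(* Only used on open sets [U].  On a finite-dimensional [V] this is the usual
   notion: [f] is C^(k+1) iff it is differentiable and all its directional
   derivatives are C^k. *)
Fixpoint Ck (R : realType) (V W : normedModType R) (k : nat) (U : set V)
    (f : V -> W) : Prop :=
  match k with
  | 0%N => forall x, U x -> {for x, continuous f}
  | k'.+1 => (forall x, U x -> differentiable f x) /\
             (forall v : V, Ck k' U (fun x => 'D_v f x))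
  end.

Definition smooth_on (R : realType) (V W : normedModType R) (U : set V)
  (f : V -> W) : Prop := forall k, Ck k U f.

(* A chart is raw data: [cmap] is meaningful on [cdom] and [cinv] on
   [cmap @` cdom]; the axioms are in [smooth_manifold]. *)
Record chart (X E : Type) := Chart {
  cdom : set X;
  cmap : X -> E;
  cinv : E -> X
}.

Definition cimg (X E : Type) (c : chart X E) : set E := cmap c @` cdom c.

(* Every point [x] comes with a preferred chart [chart_at x] around it. *)
Record chartedSpace (R : realType) (E : normedModType R) := ChartedSpace {
  carrier :> topologicalType;
  atlas : set (chart carrier E);
  chart_at : carrier -> chart carrier E;
  atlas_chart_at : forall x, atlas (chart_at x);
  cdom_chart_at : forall x, cdom (chart_at x) x
}.
Arguments atlas {R E} c : rename.
Arguments chart_at {R E} {c} _ : rename.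

Definition smooth_manifold (R : realType) (E : normedModType R)
    (X : chartedSpace E) : Prop :=
  [/\ hausdorff_space X,
      @second_countable X,
      forall c, atlas X c ->
        [/\ open (cdom c),
            open (cimg c),
            forall x, cdom c x -> cinv c (cmap c x) = x,
            forall x, cdom c x -> {for x, continuous (cmap c)} &
            forall y, cimg c y -> {for y, continuous (cinv c)}] &
      forall c c', atlas X c -> atlas X c' ->
        smooth_on (cmap c @` (cdom c `&` cdom c')) (cmap c' \o cinv c)].

Record manifold (R : realType) (d : nat) := Manifold {
  mspace :> chartedSpace 'rV[R]_d;
  mspaceP : smooth_manifold mspace
}.

Definition smooth_map (R : realType) (E F : normedModType R)
    (X : chartedSpace E) (Y : chartedSpace F) (f : X -> Y) : Prop :=
  continuous f /\
  forall c c', atlas X c -> atlas Y c' ->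
    smooth_on (cmap c @` (cdom c `&` f @^-1` cdom c')) (cmap c' \o f \o cinv c).

(* A tangent vector at [x] is represented by its components in the preferred
   chart at [x].  On a [manifold R d], tangent vectors are thus row vectors [v];
   an endomorphism of the tangent space is a matrix [A] acting by [v *m A], and
   a bilinear form is a matrix [g] with value [v *m g *m w^T]. *)
Definition tangent (R : realType) (E : normedModType R) (X : chartedSpace E)
  (x : X) : normedModType R := E.

Definition mdiff (R : realType) (E F : normedModType R) (X : chartedSpace E)
    (Y : chartedSpace F) (f : X -> Y) (x : X) :
    {linear tangent x -> tangent (f x)} :=
  'd (cmap (chart_at (f x)) \o f \o cinv (chart_at x)) (cmap (chart_at x) x).

Section Tensors.
Context {R : realType} {d : nat}.

Definition tangent_mx (M : manifold R d) (x : M) : Type := 'M[R]_d.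

(* The rows of [frame c x] are the coordinate vector fields of [c] at [x]. *)
Definition frame (M : manifold R d) (c : chart M 'rV[R]_d) (x : M) :
    tangent_mx x :=
  jacobian (cmap (chart_at x) \o cinv c) (cmap c x).

(* The matrices, in the coordinates of [c], of a bilinear form and of an
   endomorphism of the tangent space at [x]. *)
Definition form_in (M : manifold R d) (c : chart M 'rV[R]_d) (x : M)
    (g : tangent_mx x) : 'M[R]_d :=
  frame c x *m g *m (frame c x)^T.

Definition endo_in (M : manifold R d) (c : chart M 'rV[R]_d) (x : M)
    (A : tangent_mx x) : 'M[R]_d :=
  frame c x *m A *m invmx (frame c x).

Definition endo_out (M : manifold R d) (c : chart M 'rV[R]_d) (x : M)
    (B : 'M[R]_d) : tangent_mx x :=
  invmx (frame c x) *m B *m frame c x.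

Record riemannian_metric (M : manifold R d) := RiemannianMetric {
  metric :> forall x : M, tangent_mx x;
  metric_sym : forall x : M, (metric x)^T = metric x;
  metric_pos : forall (x : M) (v : 'rV[R]_d), v != 0 ->
    0 < (v *m metric x *m v^T) 0 0;
  metric_smooth : forall c, atlas M c ->
    smooth_on (cimg c) (fun y => form_in c (metric (cinv c y)))
}.

Definition orthogonal_complex (J g : 'M[R]_d) : Prop :=
  J *m J = - 1%:M /\ J *m g *m J^T = g.

Record almost_hermitian (M : manifold R d) := AlmostHermitian {
  ah_metric : riemannian_metric M;
  ah_J : forall x : M, tangent_mx x;
  ah_JP : forall x : M, orthogonal_complex (ah_J x) (ah_metric x);
  ah_J_smooth : forall c, atlas M c ->
    smooth_on (cimg c) (fun y => endo_in c (ah_J (cinv c y)))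
}.

(* An orientation of the tangent space at [x] is encoded by a boolean telling
   whether the basis given by the preferred chart is positive; the rows of [B]
   are the vectors of a basis. *)
Definition positive_basis (M : manifold R d) (o : M -> bool) (x : M)
    (B : tangent_mx x) : Prop :=
  if o x then 0 < \det B else \det B < 0.

Record orientation (M : manifold R d) := Orientation {
  orient :> M -> bool;
  orient_locally_constant : forall c x, atlas M c -> cdom c x ->
    \forall z \near x,
      positive_basis orient (frame c z) <-> positive_basis orient (frame c x)
}.

End Tensors.

Section LeviCivita.
Context {R : realType} {d : nat} (N : manifold R d) (g : riemannian_metric N).

Definition gram (c : chart N 'rV[R]_d) (y : 'rV[R]_d) : 'M[R]_d :=
  form_in c (g (cinv c y)).

Definition dgram (c : chart N 'rV[R]_d) (y : 'rV[R]_d) (i j k : 'I_d) : R :=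
  'D_(delta_mx 0 i) (fun z => gram c z j k : R^o) y.

(* [christoffel c y i j k] is the symbol with lower indices [i], [j] and upper
   index [k]. *)
Definition christoffel (c : chart N 'rV[R]_d) (y : 'rV[R]_d) (i j k : 'I_d) :
    R :=
  2^-1 * \sum_(l < d) invmx (gram c y) k l *
    (dgram c y i j l + dgram c y j i l - dgram c y l i j).

(* The connection matrix: the covariant derivative of a vector field [Y] in the
   direction [v] is ['D_v Y + Y *m connection_mx c y v]. *)
Definition connection_mx (c : chart N 'rV[R]_d) (y v : 'rV[R]_d) : 'M[R]_d :=
  \matrix_(j, k) \sum_(i < d) v 0 i * christoffel c y i j k.

End LeviCivita.

Record endT (R : realType) (d : nat) (N : manifold R d) := EndT {
  base : N;
  endo : tangent_mx base
}.

HB.instance Definition _ (R : realType) (d : nat) (N : manifold R d) :=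
  gen_eqMixin (endT N).
HB.instance Definition _ (R : realType) (d : nat) (N : manifold R d) :=
  gen_choiceMixin (endT N).

Section EndBundle.
Context {R : realType} {d : nat} (N : manifold R d).

Local Notation model := ('rV[R]_d * 'M[R]_d)%type.

Definition endT_chart (c : chart N 'rV[R]_d) : chart (endT N) model :=
  Chart [set z | cdom c (base z)]
        (fun z => (cmap c (base z), endo_in c (endo z)))
        (fun p => EndT (endo_out c (cinv c p.1) p.2)).

(* The topology for which the charts above are homeomorphisms onto open
   sets. *)
Definition endT_open (U : set (endT N)) : Prop :=
  forall c, atlas N c ->
    open [set p : model | cimg c p.1 /\ U (cinv (endT_chart c) p)].

Lemma endT_openT : endT_open setT.
Proof.
move=> c hc; have [_ _ /(_ c hc)[_ oc _ _ _] _] := mspaceP N.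
have -> : [set p : model | cimg c p.1 /\ setT (cinv (endT_chart c) p)] =
          fst @^-1` cimg c by apply/seteqP; split => p // [].
by apply: open_comp => // p _; exact: cvg_fst.
Qed.

Lemma endT_openI : setI_closed endT_open.
Proof.
move=> U V oU oV c hc.
rewrite (_ : [set _ | _] =
  [set p : model | cimg c p.1 /\ U (cinv (endT_chart c) p)] `&`
  [set p : model | cimg c p.1 /\ V (cinv (endT_chart c) p)]).
  by apply: openI; [exact: oU|exact: oV].
by apply/seteqP; split => p [] => [? []|[? ?] []].
Qed.

Lemma endT_open_bigU (I : Type) (f : I -> set (endT N)) :
  (forall i, endT_open (f i)) -> endT_open (\bigcup_i f i).
Proof.
move=> of_ c hc.
rewrite (_ : [set _ | _] = \bigcup_i
  [set p : model | cimg c p.1 /\ f i (cinv (endT_chart c) p)]).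
  by apply: bigcup_open => i _; exact: of_.
by apply/seteqP; split => p => [[? [i _ ?]]|[i _ [? ?]]];
  [exists i|split => //; exists i].
Qed.

HB.instance Definition _ := isOpenTopological.Build (endT N)
  endT_openT endT_openI endT_open_bigU.

Lemma atlas_endT_chart (z : endT N) :
  [set endT_chart c | c in atlas N] (endT_chart (chart_at (base z))).
Proof. by exists (chart_at (base z)) => //; exact: atlas_chart_at. Qed.

Lemma cdom_endT_chart (z : endT N) :
  cdom (endT_chart (chart_at (base z))) z.
Proof. exact: cdom_chart_at. Qed.

Definition endTM : chartedSpace model :=
  ChartedSpace atlas_endT_chart cdom_endT_chart.

Definition endT_proj (z : endTM) : N := base z.

Section Horizontal.
Variable g : riemannian_metric N.

Definition vertical (z : endTM) : set (tangent z) :=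
  [set w | mdiff endT_proj z w = 0].

(* For a section [A] of End(TN), viewed in coordinates, the covariant
   derivative in the direction [v] is ['D_v A + A *m G - G *m A] with [G] the
   connection matrix in the direction [v]; the map below is the induced
   connection map on the tangent space of End(TN), applied to [w = (v, 'D_v A)]. *)
Definition connection_map (z : endTM) (w : tangent z) : 'M[R]_d :=
  let p := cmap (chart_at z) z in
  let G := connection_mx g (chart_at (base z)) p.1 w.1 in
  w.2 + p.2 *m G - G *m p.2.

Definition horizontal (z : endTM) : set (tangent z) :=
  [set w | connection_map w = 0].

(* The horizontal and vertical spaces are complementary (the projection reads [(v, B) |-> v] in the
   preferred charts), so that the sets in the next two definitions are
   singletons. *)
Definition hpart (z : endTM) (w : tangent z) : tangent z :=
  xget 0 [set h | horizontal h /\ vertical (w - h)].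

(* The composite of the projection, the endomorphism [z] of the tangent space of
   [N], and the inverse of the projection restricted to horizontal vectors. *)
Definition JH (z : endTM) (h : tangent z) : tangent z :=
  xget 0 [set k : tangent z | horizontal k /\
    mdiff endT_proj z k = (mdiff endT_proj z h : 'rV[R]_d) *m endo z].

End Horizontal.

End EndBundle.

Section Twistor.
Context {R : realType} {n : nat} (N : manifold R n.*2)
  (g : riemannian_metric N) (o : orientation N).

(* The basis e_0, e_0 J, ..., e_(n-1), e_(n-1) J; only the first [n] terms of
   the sequence [e] matter. *)
Definition complex_family (e : nat -> 'rV[R]_(n.*2)) (J : 'M[R]_(n.*2)) :
    'M[R]_(n.*2) :=
  \matrix_(i < n.*2) (if odd i then e i./2 *m J else e i./2).

Definition positive_complex (x : N) (J : tangent_mx x) : Prop :=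
  forall e : nat -> 'rV[R]_(n.*2), row_free (complex_family e J) ->
    positive_basis o (complex_family e J : tangent_mx x).

(* A map into twistor space is smooth iff it is smooth as a map into End(TN),
   of which twistor space is a submanifold; the horizontal space of End(TN) at
   a point of twistor space is tangent to twistor space. *)
Record twistor_space := Twistor {
  twistor_val :> endTM N;
  twistorP : orthogonal_complex (endo twistor_val) (g (base twistor_val)) /\
             positive_complex (endo twistor_val)
}.

Definition twistor_proj (z : twistor_space) : N := endT_proj z.

Definition H_holomorphic (m : nat) (M : manifold R m.*2)
    (J : forall x : M, tangent_mx x) (psi : M -> twistor_space) : Prop :=
  let f : M -> endTM N := fun x => psi x in
  smooth_map f /\
  forall (x : M) (X : 'rV[R]_(m.*2)),
    hpart g (mdiff f x (X *m J x)) = JH g (hpart g (mdiff f x X)).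

End Twistor.

Section Pluriconformal.
Context {R : realType} {d e : nat} (M : manifold R d) (N : manifold R e).

(* The complexification of the tangent space 'rV[R]_d is 'rV[R[i]]_d; real
   matrices extend complex (bi)linearly. *)
Definition complexify (p q : nat) (A : 'M[R]_(p, q)) : 'M[R[i]]_(p, q) :=
  map_mx (real_complex R) A.

Definition T10 (J : forall x : M, tangent_mx x) (x : M) : set 'rV[R[i]]_d :=
  [set Z | Z *m complexify (J x) = Complex 0 1 *: Z].

Definition mdiff_mx (f : M -> N) (x : M) : 'M[R]_(d, e) :=
  lin1_mx (mdiff f x : 'rV[R]_d -> 'rV[R]_e).

Definition weakly_pluriconformal (J : forall x : M, tangent_mx x)
    (g : riemannian_metric N) (phi : M -> N) : Prop :=
  smooth_map phi /\
  forall (x : M) (Z W : 'rV[R[i]]_d), T10 J x Z -> T10 J x W ->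
    (Z *m complexify (mdiff_mx phi x)) *m complexify (g (phi x)) *m
      (W *m complexify (mdiff_mx phi x))^T = 0.

End Pluriconformal.

(* Main.v *)
Require Import Defs.
From mathcomp Require Import all_boot all_order all_algebra.
From mathcomp Require Import complex.
From mathcomp Require Import all_classical all_reals all_analysis.

Set Implicit Arguments.
Unset Strict Implicit.
Unset Printing Implicit Defensive.

Import Order.TTheory GRing.Theory Num.Theory.
Import numFieldNormedType.Exports.

Local Open Scope classical_set_scope.
Local Open Scope ring_scope.

(** The differential of [psi] at [x] intertwines [J] on the source with the
    horizontal complex structure on the target, up to vertical vectors, and the
    projection pi kills vertical vectors while turning the horizontal structure
    into the endomorphism [K := psi x] itself.  Hence [d phi] intertwines [J]
    and [K] ([H_holomorphic_intertwine]).  The complexified [d phi] therefore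
    maps the i-eigenspace of [J] into the i-eigenspace of [K], and that
    eigenspace is isotropic because [K] is an isometry:
    [<a, b> = <aK, bK> = <ia, ib> = - <a, b>]
    ([orthogonal_complex_isotropic]).

    In the induced charts of End(TN) the projection reads [(v, B) |-> v] and so
    does its differential ([mdiff_endT_proj]).  Both values picked by [xget] in
    [hpart] and [JH] thus have a computable first component, once the sets they
    are picked from are known to be inhabited, which follows from
    [horizontal_lift].  Smoothness of [phi] holds because in these charts it is
    the composite of [psi] with a continuous linear map. *)

(** * Local calculus *)

(** The expansion [f (x + h) = f x + df h + o(h)] only involves the values of
    [f] near [x]. *)
Lemma near_eq_diff (R : realType) (V W : normedModType R) (f g : V -> W)
    (x : V) :
  (\forall y \near x, f y = g y) -> differentiable f x ->
  differentiable g x /\ 'd g x = 'd f x :> (V -> W).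
Proof.
move=> fg df.
have fgx : f x = g x := nbhs_singleton fg.
have exp_g : g \o shift x = cst (g x) + 'd f x +o_ (0 : V) id.
  apply/eqaddoP => eps e0.
  have /eqaddoP/(_ eps e0) := diff_locally df.
  have : \forall h \near (0 : V), f (h + x) = g (h + x).
    by move: fg; rewrite (near_shift 0) subr0; apply: filterS => h.
  apply: filterS2 => h fgh.
  by rewrite /GRing.add/GRing.opp/= fgx fgh.
have dgf : 'd g x = 'd f x :> (V -> W).
  exact: diff_unique (diff_continuous df) exp_g.
split=> //; apply/diff_locallyP; rewrite dgf; split=> //.
exact: diff_continuous.
Qed.

(** Stated up to equality on [U], so that the induction goes through: ['D_v g]
    and [L \o 'D_v f] agree on [U] only, as outside [U] the directional
    derivatives are limits that need not exist. *)
Lemma Ck_linear_comp (R : realType) (V W W' : normedModType R)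
    (L : {linear W -> W'}) (U : set V) (k : nat) (f : V -> W) (g : V -> W') :
  continuous L -> open U -> (forall x, U x -> g x = L (f x)) ->
  Ck k U f -> Ck k U g.
Proof.
move=> cL oU; elim: k f g => [|k IH] f g gE /=.
  move=> cf x Ux.
  have near_x : \forall y \near x, (L \o f) y = g y.
    by apply: filterS (open_nbhs_nbhs (conj oU Ux)) => y /gE.
  apply: (@cvg_trans _ ((L \o f) y @[y --> x])).
    exact: near_eq_cvg.
  by rewrite (gE _ Ux); apply: continuous_comp (cf x Ux) (cL _).
move=> [df Cf].
have dg x (Ux : U x) : differentiable g x /\
    'd g x = L \o 'd f x :> (V -> W').
  have near_x : \forall y \near x, (L \o f) y = g y.
    by apply: filterS (open_nbhs_nbhs (conj oU Ux)) => y /gE.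
  have dL : differentiable L (f x) by exact: linear_differentiable.
  have [dgx ->] := near_eq_diff near_x (differentiable_comp (df x Ux) dL).
  by split=> //; rewrite diff_comp ?diff_lin//; exact: df.
split=> [x /dg[]//|v].
apply: IH (Cf v) => x Ux; have [dgx dgE] := dg x Ux.
by rewrite !deriveE ?dgE//; exact: df.
Qed.

Lemma fst_continuous (R : realType) (V W : normedModType R) :
  continuous (fst : (V * W)%type -> V).
Proof. by move=> p; exact: cvg_fst. Qed.

(** * The projection of End(TN) in charts *)

Lemma open_chart_preimage (R : realType) (d : nat) (M : manifold R d)
    (c : chart M 'rV[R]_d) (A : set M) :
  atlas M c -> open A -> open (cmap c @` (cdom c `&` A)).
Proof.
move=> hc oA; have [_ _ /(_ c hc)[_ oc cK _ cinvC] _] := mspaceP M.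
rewrite openE => _ [x [cx Ax] <-].
have cy : cimg c (cmap c x) by exists x.
have nc := open_nbhs_nbhs (conj oc cy).
have : \forall y \near cmap c x, A (cinv c y).
  by apply: (cinvC _ cy); rewrite (cK _ cx); apply: open_nbhs_nbhs.
rewrite /interior; apply: filterS2 nc => _ [z cz <-]; rewrite (cK _ cz) => Az.
by exists z.
Qed.

Section Projection.
Context {R : realType} {d : nat} (N : manifold R d).

Lemma chartKinv (c : chart N 'rV[R]_d) (y : 'rV[R]_d) :
  atlas N c -> cimg c y -> cmap c (cinv c y) = y.
Proof.
move=> hc [x cx <-]; have [_ _ /(_ c hc)[_ _ cK _ _] _] := mspaceP N.
by rewrite cK.
Qed.

Lemma continuous_endT_proj : continuous (@endT_proj R d N).
Proof.
apply/continuousP => A oA; change (endT_open (@endT_proj R d N @^-1` A)).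
move=> c hc; have [_ _ /(_ c hc)[_ oc _ _ cinvC] _] := mspaceP N.
have -> : [set p | cimg c p.1 /\
      (@endT_proj R d N @^-1` A) (cinv (endT_chart c) p)] =
    fst @^-1` [set y | cimg c y /\ A (cinv c y)] by [].
apply: open_comp => [p _|]; first exact: fst_continuous.
rewrite openE => y [cy Ay]; rewrite /interior.
have nA : \forall u \near y, A (cinv c u).
  by apply: (cinvC _ cy); exact: open_nbhs_nbhs.
by apply: filterS2 (open_nbhs_nbhs (conj oc cy)) nA.
Qed.

(** In the preferred charts the projection coincides with [fst] near [z]. *)
Lemma mdiff_endT_proj (z : endTM N) (w : tangent z) :
  mdiff (@endT_proj R d N) z w = w.1.
Proof.
have hc := atlas_chart_at (base z); set c := chart_at (base z) in hc.
have [_ _ /(_ c hc)[_ oc _ _ _] _] := mspaceP N.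
have cz : cimg c (cmap c (base z)).
  by exists (base z) => //; exact: cdom_chart_at.
pose model := ('rV[R]_d * 'M[R]_d)%type.
have cfst : continuous (fst : model -> 'rV[R]_d) := @fst_continuous _ _ _.
have nE : \forall p \near (cmap (chart_at z) z : model),
    p.1 = (cmap c \o @endT_proj R d N \o cinv (chart_at z)) p.
  (* [cinv c] inverts [cmap c] only over [cimg c] *)
  apply: (@filterS _ _ _ [set p : model | cimg c p.1]) => [p cp|].
    by rewrite /= chartKinv.
  by apply: cfst; exact: open_nbhs_nbhs.
have [_ dE] := near_eq_diff nE (linear_differentiable _ cfst).
by rewrite /mdiff -/c dE (diff_lin _ cfst).
Qed.

(** * Horizontal lifts *)

Variable g : riemannian_metric N.

(** The connection map is [B |-> B + p.2 *m G - G *m p.2] over a fixed [v], so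
    the vertical component is solved for explicitly. *)
Lemma horizontal_lift (z : endTM N) (v : 'rV[R]_d) :
  exists2 h : tangent z, horizontal g h & h.1 = v.
Proof.
pose p := cmap (chart_at z) z.
pose G := connection_mx g (chart_at (base z)) p.1 v.
exists (v, G *m p.2 - p.2 *m G) => //.
by rewrite /horizontal/= /connection_map/= -/p -/G subrK subrr.
Qed.

(** A vector and its horizontal part differ by a vertical vector. *)
Lemma hpart_proj (z : endTM N) (w : tangent z) : (hpart g w).1 = w.1.
Proof.
have [|_] := @xgetPex _ 0 [set h | horizontal g h /\ vertical (w - h)].
  have [h hh hE] := horizontal_lift z w.1.
  by exists h; split => //; rewrite /vertical/= mdiff_endT_proj/= hE subrr.
rewrite /vertical/= mdiff_endT_proj/= => /eqP.
by rewrite subr_eq0 => /eqP.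
Qed.

(** The horizontal lift of [h.1 *m endo z] satisfies the condition defining
    [JH g h], so the value picked satisfies it too. *)
Lemma JH_proj (z : endTM N) (h : tangent z) : (JH g h).1 = h.1 *m endo z.
Proof.
have [|_ JHE] := @xgetPex _ 0 [set k : tangent z | horizontal g k /\
    mdiff (@endT_proj R d N) z k =
    (mdiff (@endT_proj R d N) z h : 'rV[R]_d) *m endo z].
  have [k hk kE] := horizontal_lift z (h.1 *m endo z).
  by exists k; split => //; rewrite !mdiff_endT_proj kE.
by rewrite -(mdiff_endT_proj h) -JHE mdiff_endT_proj.
Qed.

(** * Maps into End(TN) and their projections *)

Section Composite.
Context {e : nat} (M : manifold R e) (f : M -> endTM N).

(** The coordinate expression of the projected map is [fst] composed with that
    of [f]. *)
Lemma smooth_endT_proj_comp :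
  smooth_map f -> smooth_map (fun x : M => endT_proj (f x)).
Proof.
move=> [cf Cf].
have cphi : continuous (fun x : M => endT_proj (f x)).
  by move=> x; apply: continuous_comp (cf x) _; exact: continuous_endT_proj.
split=> // c c' hc hc' k.
have oU : open (cmap c @` (cdom c `&` (fun x => endT_proj (f x)) @^-1` cdom c')).
  apply: open_chart_preimage => //; have [_ _ H _] := mspaceP N.
  by move/continuousP: cphi; apply; have [] := H c' hc'.
apply: (@Ck_linear_comp _ _ _ _ fst _ _
  (cmap (endT_chart c') \o f \o cinv c) _ _ oU) => //.
  exact: fst_continuous.
by apply: (Cf c (endT_chart c')) => //; exists c'.
Qed.

(** Chain rule; [f] is differentiable in the preferred charts because it is
    C^1 there. *)
Lemma mdiff_endT_proj_comp (x : M) (X : tangent x) :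
  smooth_map f ->
  mdiff (fun x : M => endT_proj (f x)) x X = (mdiff f x X).1.
Proof.
move=> [_ Cf].
pose F := cmap (chart_at (f x)) \o f \o cinv (chart_at x).
have dF : differentiable F (cmap (chart_at x) x).
  have [dF _] := Cf _ _ (atlas_chart_at x) (atlas_chart_at (f x)) 1%N.
  apply: dF; exists x => //; split; first exact: cdom_chart_at.
  exact: (cdom_chart_at (f x)).
pose model := ('rV[R]_d * 'M[R]_d)%type.
have cfst : continuous (fst : model -> 'rV[R]_d) := @fst_continuous _ _ _.
rewrite /mdiff -/F.
rewrite (_ : _ \o _ \o _ = (fst : model -> 'rV[R]_d) \o F)//.
by rewrite diff_comp ?(diff_lin _ cfst)//; exact: linear_differentiable.
Qed.

End Composite.
End Projection.

(** * Isotropy of the image of the (1,0) vectors *)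

(** An intertwining map sends i-eigenvectors of [J] to i-eigenvectors of [K];
    for two of these, applying the isometry [K] to both arguments multiplies
    [h] by [i ^+ 2 = -1] without changing it. *)
Lemma orthogonal_complex_isotropic (R : realType) (p q : nat)
    (A : 'M[R]_(p, q)) (J : 'M[R]_p) (K h : 'M[R]_q) (Z W : 'rV[R[i]]_p) :
  J *m A = A *m K -> K *m h *m K^T = h ->
  Z *m complexify J = Complex 0 1 *: Z ->
  W *m complexify J = Complex 0 1 *: W ->
  (Z *m complexify A) *m complexify h *m (W *m complexify A)^T = 0.
Proof.
move=> JA Kh ZJ WJ.
have intertwine (Y : 'rV[R[i]]_p) : Y *m complexify J = Complex 0 1 *: Y ->
    Y *m complexify A *m complexify K = Complex 0 1 *: (Y *m complexify A).
  move=> YJ.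
  rewrite -mulmxA -map_mxM -JA map_mxM mulmxA.
  by rewrite [map_mx _ J]/(complexify J) YJ -scalemxAl.
have cKh : complexify K *m complexify h *m (complexify K)^T = complexify h.
  by rewrite /complexify map_trmx -!map_mxM Kh.
move: (intertwine Z ZJ) (intertwine W WJ).
move: (Z *m complexify A) (W *m complexify A) => a b aK bK.
have ii : Complex 0 1 * Complex 0 1 = -1 :> R[i].
  apply/eqP; rewrite eq_complex/= !(mul0r, mulr0, mulr1, add0r, addr0, oppr0).
  by rewrite !eqxx.
set t := a *m _ *m _.
have tE : t = - t.
  rewrite {1}/t -cKh.
  have -> : a *m (complexify K *m complexify h *m (complexify K)^T) *m b^T =
            (a *m complexify K) *m complexify h *m (b *m complexify K)^T.
    by rewrite trmx_mul !mulmxA.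
  by rewrite aK bK linearZ/= -scalemxAr -!scalemxAl scalerA ii scaleN1r.
apply/matrixP => i j; move/matrixP/(_ i j): tE; rewrite !mxE => /eqP.
by rewrite -addr_eq0 -mulr2n mulrn_eq0 => /eqP.
Qed.

(** For each [X], the projections of [d psi (X J)], of its horizontal part, of
    [JH] applied to the horizontal part of [d psi X], and of [d psi X] followed
    by [psi x], all agree. *)
Lemma H_holomorphic_intertwine (R : realType) (m n : nat)
    (M : manifold R m.*2) (J : forall x : M, tangent_mx x)
    (N : manifold R n.*2) (g : riemannian_metric N) (o : orientation N)
    (psi : M -> twistor_space g o) (x : M) :
  H_holomorphic J psi ->
  J x *m mdiff_mx (fun y : M => twistor_proj (psi y)) x =
  mdiff_mx (fun y : M => twistor_proj (psi y)) x *m endo (twistor_val (psi x)).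
Proof.
move=> [spsi hol]; apply/row_matrixP => i; rewrite !rowE !mulmxA.
set X := delta_mx 0 i.
rewrite /mdiff_mx !mul_rV_lin1.
rewrite !(mdiff_endT_proj_comp _ spsi).
by rewrite -(hpart_proj g) hol JH_proj hpart_proj.
Qed.

Theorem mainTheorem7 (R : realType) (m n : nat)
    (M : manifold R m.*2) (hM : almost_hermitian M)
    (N : manifold R n.*2) (g : riemannian_metric N) (o : orientation N)
    (psi : M -> twistor_space g o) :
  H_holomorphic (ah_J hM) psi ->
  weakly_pluriconformal (ah_J hM) g (fun x : M => twistor_proj (psi x)).
Proof.
move=> hol; split; first exact: smooth_endT_proj_comp hol.1.
move=> x Z W ZJ WJ; have [[_ Kg] _] := twistorP (psi x).
exact: orthogonal_complex_isotropic (H_holomorphic_intertwine x hol) Kg ZJ WJ.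
Qed.
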